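(* Consider the translation of $\mathsf{CL}_{\rm b}$ to $\mathsf{CLL}_{\rm b}$ obtained by composing the Gödel-Gentzen translation $(\cdot)^{\rm G}$ with Girard's call-by-value translation $(\cdot)^*$, i.e. $A\mapsto(A^{\rm G})^*$. This composition can be presented directly in a modular (and simpler) way, i.e. for every formula $A$ of the language of $\mathsf{ILL}_\bot$ the formulas $(A^{\rm G})^*$ and $A^{{\rm G}*}$ are provably equivalent in $\mathsf{CLL}_{\rm b}$, where $A^{{\rm G}*}$ is defined inductively by: $P^{{\rm G}*}:=\,!?!P$ for $P$ atomic; $(A\otimes B)^{{\rm G}*}:=A^{{\rm G}*}\otimes B^{{\rm G}*}$; $(A\& B)^{{\rm G}*}:=\,!(A^{{\rm G}*}\& B^{{\rm G}*})$; $(A\oplus B)^{{\rm G}*}:=\,!?(A^{{\rm G}*}\oplus B^{{\rm G}*})$; $(A\multimap B)^{{\rm G}*}:=\,!(A^{{\rm G}*}\multimap B^{{\rm G}*})$; $(\forall xA)^{{\rm G}*}:=\,!\forall xA^{{\rm G}*}$; $(\exists xA)^{{\rm G}*}:=\,!?\exists xA^{{\rm G}*}$; $(!A)^{{\rm G}*}:=\,!A^{{\rm G}*}$.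
   Context: Intuitionistic linear logic $\mathsf{ILL}$ (first order). Formulas are built from atomic formulas, including the constants $1,\top,0$, using $\otimes,\&,\oplus,\multimap$, $\forall x,\exists x$ and $!$. Sequents are $\Gamma\vdash A$ with $\Gamma$ a finite multiset of formulas and exactly one formula on the right. Axioms: $A\vdash A$; $\vdash 1$; $\Gamma\vdash\top$; $\Gamma,0\vdash C$. Rules (premises $\Rightarrow$ conclusion): (cut) $\Gamma\vdash A;\ \Delta,A\vdash C\Rightarrow\Gamma,\Delta\vdash C$; $\Gamma\vdash C\Rightarrow\Gamma,1\vdash C$; $\Gamma\vdash A;\ \Delta\vdash B\Rightarrow\Gamma,\Delta\vdash A\otimes B$; $\Gamma,A,B\vdash C\Rightarrow\Gamma,A\otimes B\vdash C$; $\Gamma,A\vdash B\Rightarrow\Gamma\vdash A\multimap B$; $\Gamma\vdash A;\ \Delta,B\vdash C\Rightarrow\Gamma,\Delta,A\multimap B\vdash C$; $\Gamma\vdash A;\ \Gamma\vdash B\Rightarrow\Gamma\vdash A\& B$; $\Gamma,A\vdash C\Rightarrow\Gamma,A\& B\vdash C$; $\Gamma,B\vdash C\Rightarrow\Gamma,A\& B\vdash C$; $\Gamma\vdash A\Rightarrow\Gamma\vdash A\oplus B$; $\Gamma\vdash B\Rightarrow\Gamma\vdash A\oplus B$; $\Gamma,A\vdash C;\ \Gamma,B\vdash C\Rightarrow\Gamma,A\oplus B\vdash C$; $\Gamma\vdash A\Rightarrow\Gamma\vdash\forall xA$; $\Gamma,A[t/x]\vdash C\Rightarrow\Gamma,\forall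 xA\vdash C$; $\Gamma\vdash A[t/x]\Rightarrow\Gamma\vdash\exists xA$; $\Gamma,A\vdash C\Rightarrow\Gamma,\exists xA\vdash C$ (usual eigenvariable conditions); $\Gamma,!A,!A\vdash C\Rightarrow\Gamma,!A\vdash C$; $\Gamma\vdash C\Rightarrow\Gamma,!A\vdash C$; $!\Gamma\vdash A\Rightarrow\,!\Gamma\vdash\,!A$; $\Gamma,A\vdash C\Rightarrow\Gamma,!A\vdash C$. $\mathsf{ILL}_\bot$ extends $\mathsf{ILL}$ by one more constant $\bot$ (also counted as atomic); its sequents have at most one formula on the right (so $C$ in the rules above may be absent), and it has the additional axiom $\bot\vdash$ and rule $\Gamma\vdash\ \Rightarrow\Gamma\vdash\bot$. $\neg A:=A\multimap\bot$ and $?A:=\neg\,!\,\neg A$. $\mathsf{PRO}$: $A\vdash\,!A$; $\mathsf{DNE}$: $\neg\neg A\vdash A$ (axiom schemas). $\mathsf{CLL}_{\rm b}:=\mathsf{ILL}_\bot+\mathsf{DNE}$; $\mathsf{CL}_{\rm b}:=\mathsf{ILL}_\bot+\mathsf{PRO}+\mathsf{DNE}$. Formulas $A,B$ are provably equivalent in $S$ if $S$ proves $(A\multimap B)\&(B\multimap A)$. Gödel-Gentzen translation: $P^{\rm G}:=\neg\neg P$ ($P$ atomic); $(A\,\square\,B)^{\rm G}:=A^{\rm G}\,\square\,B^{\rm G}$ for $\square\in\{\otimes,\&,\multimap\}$; $(A\oplus B)^{\rm G}:=\neg\neg(A^{\rm G}\oplus B^{\rm G})$; $(\forall xA)^{\rm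 G}:=\forall xA^{\rm G}$; $(\exists xA)^{\rm G}:=\neg\neg\exists xA^{\rm G}$; $(!A)^{\rm G}:=\,!A^{\rm G}$. Call-by-value translation: $P^*:=\,!P$ ($P$ atomic, including $\bot$); $(A\otimes B)^*:=A^*\otimes B^*$; $(A\& B)^*:=\,!(A^*\& B^* )$; $(A\oplus B)^*:=A^*\oplus B^*$; $(A\multimap B)^*:=\,!(A^*\multimap B^* )$; $(\forall xA)^*:=\,!\forall xA^*$; $(\exists xA)^*:=\exists xA^*$; $(!A)^*:=\,!A^*$. *)

(* Defs.v *)
From Stdlib Require Import List Permutation.
From Stdlib Require Vector.
Import ListNotations.

Set Implicit Arguments.
Unset Strict Implicit.
Unset Printing Implicit Defensive.

Record signature := Signature {
  fsym : Type;
  fun_ar : fsym -> nat;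
  psym : Type;
  pred_ar : psym -> nat
}.

(* Variables are de Bruijn indices, so formulas are taken up to renaming of
   bound variables; index 0 is the variable bound by the nearest quantifier. *)
Inductive term (Sg : signature) : Type :=
| Var : nat -> term Sg
| Func : forall f : fsym Sg, Vector.t (term Sg) (fun_ar f) -> term Sg.

Arguments Var {Sg} _.
Arguments Func {Sg} f _.

(* The constants are atomic: both translations treat them by the atomic case. *)
Inductive atom (Sg : signature) : Type :=
| Pred : forall p : psym Sg, Vector.t (term Sg) (pred_ar p) -> atom Sg
| One : atom Sg
| Top : atom Sg
| Zero : atom Sg
| Bot : atom Sg.

Arguments Pred {Sg} p _.
Arguments One {Sg}.
Arguments Top {Sg}.
Arguments Zero {Sg}.
Arguments Bot {Sg}.

Inductive form (Sg : signature) : Type :=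
| Atom : atom Sg -> form Sg
| Tensor : form Sg -> form Sg -> form Sg
| With : form Sg -> form Sg -> form Sg
| Plus : form Sg -> form Sg -> form Sg
| Lolli : form Sg -> form Sg -> form Sg
| All : form Sg -> form Sg
| Ex : form Sg -> form Sg
| Bang : form Sg -> form Sg.

Definition neg Sg (A : form Sg) : form Sg := Lolli A (Atom Bot).
Definition whynot Sg (A : form Sg) : form Sg := neg (Bang (neg A)).

Fixpoint subst_term Sg (s : nat -> term Sg) (t : term Sg) : term Sg :=
  match t with
  | Var n => s n
  | Func f ts => Func f (Vector.map (subst_term s) ts)
  end.

Definition subst_atom Sg (s : nat -> term Sg) (P : atom Sg) : atom Sg :=
  match P with
  | Pred p ts => Pred p (Vector.map (subst_term s) ts)
  | One => One
  | Top => Top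
  | Zero => Zero
  | Bot => Bot
  end.

Definition shift_subst Sg (n : nat) : term Sg := Var (S n).

Definition up Sg (s : nat -> term Sg) (n : nat) : term Sg :=
  match n with
  | 0 => Var 0
  | S m => subst_term (@shift_subst Sg) (s m)
  end.

Fixpoint subst_form Sg (s : nat -> term Sg) (A : form Sg) : form Sg :=
  match A with
  | Atom P => Atom (subst_atom s P)
  | Tensor A B => Tensor (subst_form s A) (subst_form s B)
  | With A B => With (subst_form s A) (subst_form s B)
  | Plus A B => Plus (subst_form s A) (subst_form s B)
  | Lolli A B => Lolli (subst_form s A) (subst_form s B)
  | All A => All (subst_form (up s) A)
  | Ex A => Ex (subst_form (up s) A)
  | Bang A => Bang (subst_form s A)
  end.

Definition shift Sg (A : form Sg) : form Sg := subst_form (@shift_subst Sg) A.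

(* [inst t A] is A[t/x] for the body [A] of a quantifier binding x. *)
Definition inst Sg (t : term Sg) (A : form Sg) : form Sg :=
  subst_form (fun n => match n with 0 => t | S m => Var m end) A.

(* [prov Ax G C]: the sequent [G |- C] is derivable in the two-sided calculus
   with right-hand side of at most one formula ([None] is the empty one),
   extended by the axioms [A |- B] for all [A], [B] with [Ax A B].
   Antecedents are multisets: lists closed under [Permutation] by [p_perm].
   In [p_allR] and [p_exL] the eigenvariable is index 0 of the premise; it does
   not occur in the other formulas because these are shifted. *)
Inductive prov Sg (Ax : form Sg -> form Sg -> Prop) :
    list (form Sg) -> option (form Sg) -> Prop :=
| p_perm G G' C : Permutation G G' -> prov Ax G C -> prov Ax G' C
| p_ax A B : Ax A B -> prov Ax [A] (Some B)
| p_id A : prov Ax [A] (Some A)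
| p_cut G D A C :
    prov Ax G (Some A) -> prov Ax (A :: D) C -> prov Ax (G ++ D) C
| p_oneR : prov Ax [] (Some (Atom One))
| p_oneL G C : prov Ax G C -> prov Ax (Atom One :: G) C
| p_topR G : prov Ax G (Some (Atom Top))
| p_zeroL G C : prov Ax (Atom Zero :: G) C
| p_botL : prov Ax [Atom Bot] None
| p_botR G : prov Ax G None -> prov Ax G (Some (Atom Bot))
| p_tensorR G D A B :
    prov Ax G (Some A) -> prov Ax D (Some B) ->
    prov Ax (G ++ D) (Some (Tensor A B))
| p_tensorL G A B C :
    prov Ax (A :: B :: G) C -> prov Ax (Tensor A B :: G) C
| p_lolliR G A B :
    prov Ax (A :: G) (Some B) -> prov Ax G (Some (Lolli A B))
| p_lolliL G D A B C :
    prov Ax G (Some A) -> prov Ax (B :: D) C ->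
    prov Ax (Lolli A B :: G ++ D) C
| p_withR G A B :
    prov Ax G (Some A) -> prov Ax G (Some B) -> prov Ax G (Some (With A B))
| p_withL1 G A B C : prov Ax (A :: G) C -> prov Ax (With A B :: G) C
| p_withL2 G A B C : prov Ax (B :: G) C -> prov Ax (With A B :: G) C
| p_plusR1 G A B : prov Ax G (Some A) -> prov Ax G (Some (Plus A B))
| p_plusR2 G A B : prov Ax G (Some B) -> prov Ax G (Some (Plus A B))
| p_plusL G A B C :
    prov Ax (A :: G) C -> prov Ax (B :: G) C -> prov Ax (Plus A B :: G) C
| p_allR G A : prov Ax (map (@shift Sg) G) (Some A) -> prov Ax G (Some (All A))
| p_allL G A t C : prov Ax (inst t A :: G) C -> prov Ax (All A :: G) C
| p_exR G A t : prov Ax G (Some (inst t A)) -> prov Ax G (Some (Ex A))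
| p_exL G A C :
    prov Ax (A :: map (@shift Sg) G) (option_map (@shift Sg) C) ->
    prov Ax (Ex A :: G) C
| p_contr G A C : prov Ax (Bang A :: Bang A :: G) C -> prov Ax (Bang A :: G) C
| p_weak G A C : prov Ax G C -> prov Ax (Bang A :: G) C
| p_prom G A :
    prov Ax (map (@Bang Sg) G) (Some A) ->
    prov Ax (map (@Bang Sg) G) (Some (Bang A))
| p_der G A C : prov Ax (A :: G) C -> prov Ax (Bang A :: G) C.

Inductive DNE Sg : form Sg -> form Sg -> Prop :=
| dne A : DNE (neg (neg A)) A.

Definition CLLb Sg : list (form Sg) -> option (form Sg) -> Prop :=
  prov (@DNE Sg).

Definition prov_equiv Sg (S : list (form Sg) -> option (form Sg) -> Prop)
    (A B : form Sg) : Prop :=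
  S [] (Some (With (Lolli A B) (Lolli B A))).

(* Gödel-Gentzen translation. *)
Fixpoint GG Sg (A : form Sg) : form Sg :=
  match A with
  | Atom P => neg (neg (Atom P))
  | Tensor A B => Tensor (GG A) (GG B)
  | With A B => With (GG A) (GG B)
  | Plus A B => neg (neg (Plus (GG A) (GG B)))
  | Lolli A B => Lolli (GG A) (GG B)
  | All A => All (GG A)
  | Ex A => neg (neg (Ex (GG A)))
  | Bang A => Bang (GG A)
  end.

(* Girard's call-by-value translation. *)
Fixpoint cbv Sg (A : form Sg) : form Sg :=
  match A with
  | Atom P => Bang (Atom P)
  | Tensor A B => Tensor (cbv A) (cbv B)
  | With A B => Bang (With (cbv A) (cbv B))
  | Plus A B => Plus (cbv A) (cbv B)
  | Lolli A B => Bang (Lolli (cbv A) (cbv B))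
  | All A => Bang (All (cbv A))
  | Ex A => Ex (cbv A)
  | Bang A => Bang (cbv A)
  end.

(* The direct presentation of the composition [cbv (GG A)]. *)
Fixpoint GGcbv Sg (A : form Sg) : form Sg :=
  match A with
  | Atom P => Bang (whynot (Bang (Atom P)))
  | Tensor A B => Tensor (GGcbv A) (GGcbv B)
  | With A B => Bang (With (GGcbv A) (GGcbv B))
  | Plus A B => Bang (whynot (Plus (GGcbv A) (GGcbv B)))
  | Lolli A B => Bang (Lolli (GGcbv A) (GGcbv B))
  | All A => Bang (All (GGcbv A))
  | Ex A => Bang (whynot (Ex (GGcbv A)))
  | Bang A => Bang (GGcbv A)
  end.

(* Main.v *)
(** Every call-by-value translation [X] is positive, i.e. [X |- !X].  The clauses
    on which the two translations differ compare the call-by-value translation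
    [!(!(X -o !bot) -o !bot)] of [neg neg X] with [!?X = !(!(X -o bot) -o bot)];
    since [X |- !X], promotion applies to the derivation [X, !(X -o bot) |- bot],
    so that [!(X -o bot)] entails [!(X -o !bot)]. *)

From Stdlib Require Import List Permutation.
Require Import Defs.
Import ListNotations.

Set Implicit Arguments.
Unset Strict Implicit.
Unset Printing Implicit Defensive.

Lemma subst_term_renK Sg (s : nat -> term Sg) (r : nat -> nat)
    (rK : forall n, s (r n) = Var n) :
  forall t, subst_term s (subst_term (fun n => Var (r n)) t) = t.
Proof.
  (* The arguments of [Func] are nested in a vector, so a raw fixpoint on terms encloses an
     induction on that vector. *)
  fix IH 1; intros [n | f ts]; simpl; [apply rK |].
  f_equal; induction ts as [| t k ts IHts]; simpl; [reflexivity |].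
  rewrite IH, IHts; reflexivity.
Qed.

Lemma subst_term_ext Sg (s s' : nat -> term Sg) (ss' : forall n, s n = s' n) :
  forall t, subst_term s t = subst_term s' t.
Proof.
  fix IH 1; intros [n | f ts]; simpl; [apply ss' |].
  f_equal; induction ts as [| t k ts IHts]; simpl; [reflexivity |].
  rewrite IH, IHts; reflexivity.
Qed.

Lemma subst_atom_renK Sg (s s' : nat -> term Sg) (r : nat -> nat) (P : atom Sg) :
  (forall n, s' n = Var (r n)) -> (forall n, s (r n) = Var n) ->
  subst_atom s (subst_atom s' P) = P.
Proof.
  intros s'E rK; destruct P as [p ts | | | |]; simpl; try reflexivity.
  f_equal; induction ts as [| t k ts IHts]; simpl; [reflexivity |].
  rewrite (subst_term_ext s'E), (subst_term_renK rK), IHts; reflexivity.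
Qed.

(** The substitutions are constrained only pointwise: under a quantifier [up s] and [up s'] satisfy
    the same equations for the lifted renaming, so the induction needs no functional
    extensionality. *)
Lemma subst_form_renK Sg (A : form Sg) : forall (s s' : nat -> term Sg) (r : nat -> nat),
  (forall n, s' n = Var (r n)) -> (forall n, s (r n) = Var n) ->
  subst_form s (subst_form s' A) = A.
Proof.
  assert (upE : forall (s' : nat -> term Sg) r, (forall n, s' n = Var (r n)) ->
    forall n, up s' n = Var (match n with 0 => 0 | S m => S (r m) end)).
  { intros s' r s'E [| m]; simpl; [| rewrite s'E]; reflexivity. }
  assert (upK : forall (s : nat -> term Sg) r, (forall n, s (r n) = Var n) ->
    forall n, up s (match n with 0 => 0 | S m => S (r m) end) = Var n).
  { intros s r rK [| m]; simpl; [| rewrite rK]; reflexivity. }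
  induction A as [P | A IHA B IHB | A IHA B IHB | A IHA B IHB | A IHA B IHB
                 | A IHA | A IHA | A IHA]; intros s s' r s'E rK; simpl; f_equal;
    solve [eapply subst_atom_renK; eassumption | eapply IHA; eassumption
          | eapply IHB; eassumption | eapply IHA; [apply upE | apply upK]; eassumption].
Qed.

(** Serves the quantifier rules: the eigenvariable rule shifts a quantified formula on the other
    side of the sequent, and instantiating it at the eigenvariable [Var 0] recovers the original
    body. *)
Lemma inst_up_shift Sg (A : form Sg) :
  inst (Var 0) (subst_form (up (@shift_subst Sg)) A) = A.
Proof.
  apply subst_form_renK with (r := fun n => match n with 0 => 0 | S m => S (S m) end);
    intros [| n]; reflexivity.
Qed.

Section Entailment.

Variables (Sg : signature) (Ax : form Sg -> form Sg -> Prop).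

Definition entails (A B : form Sg) : Prop := prov Ax [A] (Some B).

Definition positive (A : form Sg) : Prop := entails A (Bang A).

Lemma cut_entails A B G C : entails A B -> prov Ax (B :: G) C -> prov Ax (A :: G) C.
Proof. exact (@p_cut Sg Ax [A] G B C). Qed.

Lemma entails_trans A B C : entails A B -> entails B C -> entails A C.
Proof. apply cut_entails. Qed.

Lemma prov_swap A B G C : prov Ax (A :: B :: G) C -> prov Ax (B :: A :: G) C.
Proof. apply p_perm, perm_swap. Qed.

Lemma modus_ponens A B : prov Ax [Lolli A B; A] (Some B).
Proof. exact (p_lolliL (p_id Ax A) (p_id Ax B)). Qed.

Lemma entails_tensor A A' B B' :
  entails A A' -> entails B B' -> entails (Tensor A B) (Tensor A' B').
Proof. intros hA hB; apply p_tensorL; exact (p_tensorR hA hB). Qed.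

Lemma entails_with A A' B B' :
  entails A A' -> entails B B' -> entails (With A B) (With A' B').
Proof. intros hA hB; apply p_withR; [apply p_withL1 | apply p_withL2]; assumption. Qed.

Lemma entails_plus A A' B B' :
  entails A A' -> entails B B' -> entails (Plus A B) (Plus A' B').
Proof. intros hA hB; apply p_plusL; [apply p_plusR1 | apply p_plusR2]; assumption. Qed.

Lemma entails_lolli A A' B B' :
  entails A' A -> entails B B' -> entails (Lolli A B) (Lolli A' B').
Proof. intros hA hB; apply p_lolliR, prov_swap; exact (p_lolliL hA hB). Qed.

Lemma entails_all A A' : entails A A' -> entails (All A) (All A').
Proof.
  intros hA; apply p_allR; simpl; apply p_allL with (t := Var 0).
  rewrite inst_up_shift; exact hA.
Qed.

Lemma entails_ex A A' : entails A A' -> entails (Ex A) (Ex A').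
Proof.
  intros hA; apply p_exL; simpl; apply p_exR with (t := Var 0).
  rewrite inst_up_shift; exact hA.
Qed.

Lemma prom1 A B : entails (Bang A) B -> entails (Bang A) (Bang B).
Proof. exact (@p_prom Sg Ax [A] B). Qed.

Lemma prom2 A B C :
  prov Ax [Bang A; Bang B] (Some C) -> prov Ax [Bang A; Bang B] (Some (Bang C)).
Proof. exact (@p_prom Sg Ax [A; B] C). Qed.

Lemma entails_bang A A' : entails A A' -> entails (Bang A) (Bang A').
Proof. intros hA; apply prom1, p_der, hA. Qed.

Lemma entails_whynot A A' : entails A A' -> entails (whynot A) (whynot A').
Proof.
  intros hA; apply entails_lolli; [apply entails_bang, entails_lolli |]; trivial; apply p_id.
Qed.

Lemma positive_bang A : positive (Bang A).
Proof. apply prom1, p_id. Qed.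

Lemma positive_tensor A B : positive A -> positive B -> positive (Tensor A B).
Proof.
  (* Positivity replaces both components by their banged forms, which makes promotion applicable. *)
  intros hA hB; apply p_tensorL, (cut_entails hA), prov_swap, (cut_entails hB).
  apply prov_swap, prom2, p_der, prov_swap, p_der, prov_swap.
  exact (p_tensorR (p_id Ax A) (p_id Ax B)).
Qed.

Lemma positive_plus A B : positive A -> positive B -> positive (Plus A B).
Proof.
  intros hA hB; apply p_plusL;
    [apply (entails_trans hA) | apply (entails_trans hB)]; apply entails_bang;
    [apply p_plusR1 | apply p_plusR2]; apply p_id.
Qed.

Lemma positive_ex A : positive A -> positive (Ex A).
Proof.
  intros hA; apply p_exL; simpl; apply (entails_trans hA), entails_bang.
  apply p_exR with (t := Var 0); rewrite inst_up_shift; apply p_id.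
Qed.

(** Each clause of [cbv] either starts with [Bang] or uses [Tensor], [Plus] or [Ex], which preserve
    positivity. *)
Lemma positive_cbv A : positive (cbv A).
Proof.
  induction A; simpl; auto using positive_bang, positive_tensor, positive_plus, positive_ex.
Qed.

Lemma entails_neg_bang_bot A : entails (Lolli A (Bang (Atom Bot))) (neg A).
Proof. apply entails_lolli; [apply p_id | apply p_der, p_id]. Qed.

Lemma positive_entails_neg_bang_bot A :
  positive A -> entails (Bang (neg A)) (Lolli A (Bang (Atom Bot))).
Proof.
  intros hA; apply p_lolliR, (cut_entails hA), prom2, p_der, prov_swap, p_der.
  apply modus_ponens.
Qed.

(** The premise leaves room for the induction hypothesis, which passes through the monotone
    [Bang (whynot _)]. *)
Lemma cbv_neg_neg_entails A B : entails (cbv A) B ->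
  entails (cbv (neg (neg A))) (Bang (whynot B)).
Proof.
  intros hAB; apply entails_trans with (Bang (whynot (cbv A)));
    [| apply entails_bang, entails_whynot, hAB].
  (* The outer [Bang (Atom Bot)] is covariant and is removed by dereliction; the inner one is
     contravariant and has to be introduced, which is where positivity enters. *)
  apply entails_bang, entails_lolli; [| apply p_der, p_id].
  apply prom1, positive_entails_neg_bang_bot, positive_cbv.
Qed.

Lemma entails_cbv_neg_neg A B : entails B (cbv A) ->
  entails (Bang (whynot B)) (cbv (neg (neg A))).
Proof.
  intros hBA; apply entails_trans with (Bang (whynot (cbv A)));
    [apply entails_bang, entails_whynot, hBA |].
  (* After [p_lolliR] both antecedent formulas are banged, so [prom2] reduces the goal
     [Bang (Atom Bot)] to [Atom Bot]. *)
  apply prom1, p_lolliR, prom2, prov_swap, p_der, prov_swap.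
  apply (cut_entails (entails_bang (entails_neg_bang_bot (cbv A)))).
  apply prov_swap, modus_ponens.
Qed.

Lemma cbv_GG_GGcbv A : entails (cbv (GG A)) (GGcbv A) /\ entails (GGcbv A) (cbv (GG A)).
Proof.
  induction A as [P | A [] B [] | A [] B [] | A [] B [] | A [] B [] | A [] | A [] | A []];
    (* [cbv] stays folded at first, so that the double negations of the atomic, [Plus] and [Ex]
       clauses are still visible to the two lemmas; the other clauses follow by monotonicity. *)
    cbn [GG GGcbv]; split; try apply cbv_neg_neg_entails; try apply entails_cbv_neg_neg;
    cbn [cbv]; auto using entails_bang, entails_tensor, entails_with, entails_plus,
      entails_lolli, entails_all, entails_ex; apply p_id.
Qed.

End Entailment.

Theorem theorem2 (Sg : signature) (A : form Sg) :
  prov_equiv (@CLLb Sg) (cbv (GG A)) (GGcbv A).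
Proof.
  apply p_withR; apply p_lolliR; apply cbv_GG_GGcbv.
Qed.
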